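(* Let $q$ be a prime power and let $C\neq\{0\}$ be an expander code over $\mathbb{F}_q$ of length $n$ with parameters $\Delta_1,\Delta_2,R_1,R_2$, $b_1=n/\Delta_1$ (as defined in the context), and let $R=\dim_{\mathbb{F}_q}(C)/n$ be its rate. Then its minimum Hamming distance $d(C)$ satisfies $$d(C)\le \min_{b'}\left\{\frac{q^{\widetilde{k}-1}(q-1)}{q^{\widetilde{k}}-1}\,b'\Delta_1\right\},$$ where $\widetilde{k}=\widetilde{k}(b')=b'R_1\Delta_1-(R_1-R)n$ and the minimum is over all $b'\in\mathbb{N}$ with $$\frac{R_1-R}{R_1}\,b_1+\frac{1}{R_1\Delta_1}\le b'\le b_1 .$$
   Context: Expander codes. Let $G=(V_1:V_2,E)$ be a finite bipartite undirected connected graph (parallel edges permitted) with vertex set $V=V_1\cup V_2$, $V_1\cap V_2=\emptyset$, every edge joining $V_1$ to $V_2$, such that every $u\in V_1$ has degree $\Delta_1$ and every $v\in V_2$ has degree $\Delta_2$. Put $n=|E|$, so $|V_1|=b_1=n/\Delta_1$ and $|V_2|=b_2=n/\Delta_2$. Fix an ordering of $E$. For a vertex $u$, let $E(u)$ be the set of edges incident with $u$, and for a word $\mathbf{z}=(z_e)_{e\in E}$ let $(\mathbf{z})_{E(u)}$ be the sub-block of $\mathbf{z}$ indexed by $E(u)$. To each vertex $u_i\in V_1$ ($i=1,\dots,b_1$) associate a linear code $C^{(1)}_i$ over $\mathbb{F}_q$ of length $\Delta_1$ and dimension $R_1\Delta_1$, and to each vertex $v_j\in V_2$ ($j=1,\dots,b_2$)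 a linear code $C^{(2)}_j$ over $\mathbb{F}_q$ of length $\Delta_2$ and dimension $R_2\Delta_2$ (the codes may differ from vertex to vertex, but $R_1$ and $R_2$ are the same for all vertices of $V_1$ and of $V_2$, respectively). The corresponding expander code is $$C=\{\mathbf{c}\in\mathbb{F}_q^{|E|}:\ (\mathbf{c})_{E(u_i)}\in C^{(1)}_i\ \forall u_i\in V_1\ \text{ and }\ (\mathbf{c})_{E(v_j)}\in C^{(2)}_j\ \forall v_j\in V_2\}.$$ It is a linear code of length $n$. *)

(* Defs.v *)
From HB Require Import structures.
From mathcomp Require Import all_boot all_order all_algebra.

Set Implicit Arguments.
Unset Strict Implicit.
Unset Printing Implicit Defensive.
Import Order.TTheory GRing.Theory Num.Theory.
Local Open Scope ring_scope.

Definition is_minimum (S : rat -> Prop) (m : rat) : Prop :=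
  S m /\ forall x : rat, S x -> m <= x.

Section BipartiteGraph.
Variables (V1 V2 : finType) (n : nat).

Definition bip_adj (end1 : 'I_n -> V1) (end2 : 'I_n -> V2) : rel (V1 + V2) :=
  fun x y => match x, y with
  | inl u, inr v | inr v, inl u => [exists e, (end1 e == u) && (end2 e == v)]
  | _, _ => false
  end.

(* The vertex set is the disjoint sum V1 + V2 and the ordered edge set is 'I_n;
   edges are abstract indices mapped to their two ends, so that parallel edges
   are permitted. *)
Record bipartite_graph (Delta1 Delta2 : nat) := BipartiteGraph {
  end1 : 'I_n -> V1;
  end2 : 'I_n -> V2;
  deg1 : forall u : V1, #|[set e | end1 e == u]| = Delta1;
  deg2 : forall v : V2, #|[set e | end2 e == v]| = Delta2;
  bip_connected : forall x y : V1 + V2, connect (bip_adj end1 end2) x y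
}.

End BipartiteGraph.

Section ExpanderCode.
Variables (V1 V2 : finType) (n Delta1 Delta2 : nat).
Variables (F : finFieldType) (G : bipartite_graph V1 V2 n Delta1 Delta2).

(* enum_val lists the edges at a vertex in increasing order of their index. *)
Definition subblock1 (u : V1) (z : 'rV[F]_n) : 'rV[F]_Delta1 :=
  colsub (fun j : 'I_Delta1 => enum_val (cast_ord (esym (deg1 G u)) j)) z.

Definition subblock2 (v : V2) (z : 'rV[F]_n) : 'rV[F]_Delta2 :=
  colsub (fun j : 'I_Delta2 => enum_val (cast_ord (esym (deg2 G v)) j)) z.

(* An intersection of preimages, so that the code comes with its vector space
   structure; expander_codeP below spells out membership. *)
Definition expander_code (C1 : V1 -> {vspace 'rV[F]_Delta1})
    (C2 : V2 -> {vspace 'rV[F]_Delta2}) : {vspace 'rV[F]_n} :=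
  ((\bigcap_(u : V1) (linfun (subblock1 u) @^-1: C1 u)) :&:
   (\bigcap_(v : V2) (linfun (subblock2 v) @^-1: C2 v)))%VS.

Lemma expander_codeP (C1 : V1 -> {vspace 'rV[F]_Delta1})
    (C2 : V2 -> {vspace 'rV[F]_Delta2}) (c : 'rV[F]_n) :
  c \in expander_code C1 C2 <->
  (forall u, subblock1 u c \in C1 u) /\ (forall v, subblock2 v c \in C2 v).
Proof.
have E1 u : (c \in linfun (subblock1 u) @^-1: C1 u)%VS = (subblock1 u c \in C1 u).
  by rewrite -memv_preim /subblock1 lfunE.
have E2 v : (c \in linfun (subblock2 v) @^-1: C2 v)%VS = (subblock2 v c \in C2 v).
  by rewrite -memv_preim /subblock2 lfunE.
rewrite /expander_code memv_cap [X in X && _]memvE [X in _ && X]memvE; split.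
  case/andP=> /subv_bigcapP H1 /subv_bigcapP H2; split=> w.
    by rewrite -E1 memvE; exact: H1.
  by rewrite -E2 memvE; exact: H2.
case=> H1 H2; apply/andP; split; apply/subv_bigcapP=> w _.
  by rewrite -memvE E1.
by rewrite -memvE E2.
Qed.

End ExpanderCode.

Section Code.
Variables (F : finFieldType) (n : nat).

Definition hamming_dist (x y : 'rV[F]_n) : nat :=
  #|[set i : 'I_n | x 0 i != y 0 i]|.

(* The neutral value n bounds every Hamming distance, so it does not alter the
   minimum; it is only the conventional value for the zero code. *)
Definition min_dist (C : {vspace 'rV[F]_n}) : nat :=
  \big[minn/n]_(p : 'rV[F]_n * 'rV[F]_n |
                [&& p.1 \in C, p.2 \in C & p.1 != p.2]) hamming_dist p.1 p.2.

Definition code_rate (C : {vspace 'rV[F]_n}) : rat := (\dim C)%:R / n%:R.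

End Code.

Definition ktilde (n Delta1 : nat) (R1 R : rat) (b' : nat) : rat :=
  b'%:R * R1 * Delta1%:R - (R1 - R) * n%:R.

(* For an expander code ktilde is an integer, being b' dim C1_i - b1 dim C1_i
   + dim C; Num.floor only retypes it so that it can serve as an exponent. *)
Definition plotkin_term (q n Delta1 : nat) (R1 R : rat) (b' : nat) : rat :=
  let k := Num.floor (ktilde n Delta1 R1 R b') in
  q%:R ^ (k - 1) * (q%:R - 1) / (q%:R ^ k - 1) * (b'%:R * Delta1%:R).

Definition admissible (b1 Delta1 : nat) (R1 R : rat) (b' : nat) : Prop :=
  (R1 - R) / R1 * b1%:R + 1 / (R1 * Delta1%:R) <= b'%:R /\ (b' <= b1)%N.

(* Main.v *)
(** Discarding all edges at [b1 - b'] of the vertices of [V1] imposes at most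
    [(b1 - b') R1 Delta1] linear conditions on [C], so the codewords supported on
    the [b' Delta1] edges at the remaining [b'] vertices form a subcode of
    dimension at least [ktilde]. Plotkin's averaging argument, applied to a
    subspace of dimension exactly [ktilde] of this shortened code, gives the
    bound. *)
Require Import Defs.
From mathcomp Require Import all_boot all_order all_algebra.
From mathcomp Require Import finfield.
From mathcomp Require Import zify ring lra.
Import Order.TTheory GRing.Theory Num.Theory.
Local Open Scope ring_scope.

Lemma exists_subspace (K : fieldType) (vT : vectType K) (U : {vspace vT})
    (k : nat) :
  (k <= \dim U)%N -> exists2 W : {vspace vT}, (W <= U)%VS & \dim W = k.
Proof.
move=> le_k; pose X := vbasis U.
have szX : size X = \dim U by rewrite size_tuple.
exists <<take k X>>%VS.
  apply/span_subvP => v /mem_take; exact: vbasis_mem.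
have /eqP -> : free (take k X).
  by apply: (@catl_free _ _ (drop k X)); rewrite cat_take_drop (basis_free (vbasisP U)).
by rewrite size_take szX; case: ltnP => // /(conj le_k)/andP/anti_leq.
Qed.

(** By rank-nullity, cutting with one more kernel costs at most the rank of [f i] on the current
    space. Bounding that rank on [U] only, not on all of [vT], is what later gives a cost of [k1]
    per vertex instead of [Delta1]. *)
Lemma dim_cap_lkers (K : fieldType) (vT wT : vectType K) (I : eqType)
    (f : I -> 'Hom(vT, wT)) (k : nat) (U : {vspace vT}) (s : seq I) :
    (forall i, \dim (f i @: U) <= k)%N ->
  exists W : {vspace vT}, [/\ (W <= U)%VS,
    forall i v, i \in s -> v \in W -> f i v = 0
    & (\dim U <= \dim W + size s * k)%N].
Proof.
move=> dim_f; elim: s => [|i s [W [sWU W0 dimW]]].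
  by exists U; split; rewrite ?mul0n ?addn0.
exists (W :&: lker (f i))%VS; split.
- exact: subv_trans (capvSl _ _) sWU.
- move=> j v; rewrite memv_cap inE memv_ker => js /andP[Wv /eqP fv0].
  by case/orP: js => [/eqP-> // | js]; apply: W0.
- apply: leq_trans dimW _; rewrite -(limg_ker_dim (f i) W) -addnA leq_add2l /=.
  by rewrite mulSn leq_add2r (leq_trans (dimvS (limgS _ sWU))).
Qed.

(** The words of [D] vanishing at [i] form the kernel of a linear functional on [D], so they have
    codimension at most one. For [\dim D = 0] the truncated predecessor makes the bound 0, which is
    still correct. *)
Lemma card_nonzero_coord (F : finFieldType) (n : nat) (D : {vspace 'rV[F]_n})
    (i : 'I_n) :
  (#|[set c in D | c 0%R i != 0%R]| <= #|F| ^ \dim D - #|F| ^ (\dim D).-1)%N.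
Proof.
pose f := linfun (colsub (fun _ : 'I_1 => i) : 'rV[F]_n -> 'rV[F]_1).
have fE (c : 'rV[F]_n) : (c \in lker f) = (c 0 i == 0).
  rewrite memv_ker lfunE /=; apply/eqP/eqP => [/rowP/(_ ord0) | ci0].
    by rewrite !mxE.
  by apply/rowP => j; rewrite !mxE.
have dim_ker : ((\dim D).-1 <= \dim (D :&: lker f))%N.
  have dim1 : (\dim (f @: D) <= 1)%N.
    by apply: leq_trans (dimvS (subvf _)) _; rewrite dimvf dim_matrix.
  by rewrite -(limg_ker_dim f D) -subn1 leq_subLR addnC leq_add2r.
have -> : (#|F| ^ \dim D = #|[set c in D | c 0%R i != 0%R]| + #|F| ^ \dim (D :&: lker f))%N.
  rewrite -!card_vspace addnC -(cardID (mem (lker f)) D).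
  congr (_ + _)%N; apply: eq_card => c; rewrite !inE /= ?memv_cap //.
  by rewrite fE andbC.
rewrite -addnBA; last exact: leq_pexp2l (ltnW (finNzRing_gt1 F)) dim_ker.
exact: leq_addr.
Qed.

(** Double counting of the total weight of [D]: each nonzero word contributes at least [d], each
    coordinate in [A] at most the bound of [card_nonzero_coord], and coordinates outside [A]
    nothing. *)
Lemma plotkin_bound (F : finFieldType) (n d : nat) (D : {vspace 'rV[F]_n})
    (A : {set 'I_n}) :
    (forall c i, c \in D -> i \notin A -> c 0 i = 0) ->
    (forall c, c \in D -> c != 0 -> (d <= hamming_dist c 0)%N) ->
  (d * (#|F| ^ \dim D - 1) <=
   #|A| * (#|F| ^ \dim D - #|F| ^ (\dim D).-1))%N.
Proof.
move=> supp_D dist_D.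
have -> : (#|F| ^ \dim D - 1 = #|[set c in D | c != 0%R]|)%N.
  rewrite -card_vspace (cardD1 0) mem0v add1n subn1 /=.
  by apply: eq_card => c; rewrite !inE andbC.
rewrite mulnC -sum_nat_const.
have wtE (c : 'rV[F]_n) : c \in D ->
    hamming_dist c 0 = (\sum_(i in A) (c 0%R i != 0%R))%N.
  move=> Dc; rewrite /hamming_dist -sum1_card big_mkcond [RHS]big_mkcond /=.
  apply: eq_bigr => i _; rewrite inE mxE.
  by case: (boolP (i \in A)) => [_|/(supp_D c i Dc) ->]; case: eqP.
apply: (@leq_trans (\sum_(c in D) \sum_(i in A) (c 0%R i != 0%R))%N).
  rewrite big_mkcond [leqRHS]big_mkcond /=; apply: leq_sum => c _.
  rewrite inE; case: ifP => [/andP[Dc c0]|_ //].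
  by rewrite Dc -wtE // dist_D.
rewrite exchange_big /= -sum_nat_const; apply: leq_sum => i _.
apply: leq_trans (card_nonzero_coord _ _ D i).
rewrite -sum1_card big_mkcond [leqRHS]big_mkcond /=; apply: leq_sum => c _.
by rewrite inE; case: (c \in D) => //=; case: (c 0 i != 0).
Qed.

Lemma min_dist_le (F : finFieldType) (n : nat) (C : {vspace 'rV[F]_n}) c :
  c \in C -> c != 0 -> (min_dist C <= hamming_dist c 0)%N.
Proof.
move=> Cc c0; rewrite /min_dist -minEnat.
apply: (@bigmin_le_cond _ nat _ n (c, 0) _
  (fun p : 'rV[F]_n * 'rV[F]_n => hamming_dist p.1 p.2)).
by rewrite /= Cc mem0v c0.
Qed.

Section ExpanderCode.
Variables (F : finFieldType) (V1 V2 : finType) (n Delta1 Delta2 : nat).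
Variable G : bipartite_graph V1 V2 n Delta1 Delta2.

(** Each edge has exactly one end in [V1], so the edges split into classes of size [Delta1] indexed
    by that end. *)
Lemma card_incident_edges (T : {set V1}) :
  #|[set e | end1 G e \in T]| = (#|T| * Delta1)%N.
Proof.
rewrite -sum1_card (partition_big (end1 G) (mem T)) => [|e]; last by rewrite inE.
rewrite -sum_nat_const; apply: eq_bigr => u Tu.
apply: etrans (deg1 G u); rewrite -sum1_card; apply: eq_bigl => e.
by rewrite !inE; case: eqP => [->|]; rewrite ?andbF ?andbT.
Qed.

Lemma card_edges : (#|V1| * Delta1)%N = n.
Proof.
rewrite -cardsT -card_incident_edges -[RHS](card_ord n).
by apply: eq_card => e; rewrite !inE.
Qed.

Lemma subblock1_eq0 u (c : 'rV[F]_n) :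
  subblock1 G u c = 0 -> forall e, end1 G e = u -> c 0 e = 0.
Proof.
move=> c0 e eu; have ein : e \in [set e | end1 G e == u] by rewrite inE eu.
move/rowP/(_ (cast_ord (deg1 G u) (enum_rank_in ein e))): c0.
by rewrite !mxE cast_ordK enum_rankK_in.
Qed.

Variables (C1 : V1 -> {vspace 'rV[F]_Delta1}) (C2 : V2 -> {vspace 'rV[F]_Delta2}).
Let C := expander_code G C1 C2.

Lemma shortened_code (k1 b' : nat) :
    (forall u, \dim (C1 u) = k1) -> (b' <= #|V1|)%N ->
  exists W (A : {set 'I_n}), [/\ (W <= C)%VS, #|A| = (b' * Delta1)%N,
    forall c i, c \in W -> i \notin A -> c 0 i = 0
    & (\dim C <= \dim W + (#|V1| - b') * k1)%N].
Proof.
move=> dimC1 le_b'; pose f u := linfun (subblock1 G u : 'rV[F]_n -> 'rV[F]_Delta1).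
have fE u c : f u c = subblock1 G u c by rewrite /f /subblock1 lfunE.
have [|W [sWC W0 dimW]] := @dim_cap_lkers _ _ _ _ f k1 C (drop b' (enum V1)).
  (* On [C] the sub-block map at [u] takes values in [C1 u], so its rank there is at most [k1]. *)
  move=> u; rewrite -(dimC1 u); apply/dimvS/subvP => _ /memv_imgP[c Cc ->].
  by rewrite fE; case/expander_codeP: Cc => /(_ u).
exists W, [set e | end1 G e \in [set u in take b' (enum V1)]]; split=> //.
- rewrite card_incident_edges cardsE (card_uniqP _) ?take_uniq ?enum_uniq //.
  by rewrite size_takel -?cardE.
- move=> c e Wc; rewrite !inE => e_take.
  have := mem_enum V1 (end1 G e); rewrite -[enum V1](cat_take_drop b').
  rewrite mem_cat (negbTE e_take) /= inE => e_drop.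
  have := W0 _ _ e_drop Wc; rewrite fE => /subblock1_eq0; exact.
- by rewrite size_drop -cardE in dimW.
Qed.

(** Shortening with [b' = 0] leaves no edge, hence only the zero word, and the dimension estimate
    becomes the claim. *)
Lemma dim_expander_code (k1 : nat) :
  (forall u, \dim (C1 u) = k1) -> (\dim C <= #|V1| * k1)%N.
Proof.
move=> dimC1; have [//|W [A [_ /cards0_eq A0 W0]]] := shortened_code k1 0 dimC1.
suff -> : W = 0%VS by rewrite dimv0 subn0.
apply/eqP; rewrite -subv0; apply/subvP => c Wc; rewrite memv0.
by apply/eqP/rowP => i; rewrite mxE W0 // A0 inE.
Qed.

(** The last hypothesis is the definition of [ktilde], written without subtraction. Cutting the
    shortened code down to dimension exactly [k] avoids any monotonicity argument in the
    exponent. *)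
Lemma min_dist_shortened (k1 k b' : nat) :
    (forall u, \dim (C1 u) = k1) -> (b' <= #|V1|)%N ->
    (k + #|V1| * k1 = b' * k1 + \dim C)%N ->
  (min_dist C * (#|F| ^ k - 1) <= b' * Delta1 * (#|F| ^ k - #|F| ^ k.-1))%N.
Proof.
move=> dimC1 le_b' kE.
have [W [A [sWC <- W0 dimW]]] := shortened_code _ _ dimC1 le_b'.
have [|D sDW <-] := @exists_subspace _ _ W k.
  by move: dimW; rewrite mulnBl; have := leq_mul2r k1 b' #|V1|; lia.
apply: plotkin_bound => [c i /(subvP sDW)|c /(subvP (subv_trans sDW sWC))].
  exact: W0.
exact: min_dist_le.
Qed.

End ExpanderCode.

(** Factor [q ^ k - q ^ k.-1] as [q ^ k.-1 * (q - 1)] and divide by [q ^ k - 1], which is positive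
    since [q > 1] and [k > 0]. *)
Lemma min_dist_le_ratio (q d m k : nat) : (1 < q)%N -> (0 < k)%N ->
    (d * (q ^ k - 1) <= m * (q ^ k - q ^ k.-1))%N ->
  d%:R <= q%:R ^ (k%:Z - 1) * (q%:R - 1) / (q%:R ^ k - 1) * m%:R :> rat.
Proof.
case: k => [//|k] q_gt1 _ /= le_dm; have q_gt0 := ltnW q_gt1.
have -> : k.+1%:Z - 1 = k :> int by lia.
rewrite -!exprnP mulrAC ler_pdivlMr; last first.
  by rewrite subr_gt0 -natrX ltr1n (ltn_exp2l 0).
move: le_dm; rewrite -(ler_nat rat) !natrM !natrB ?expn_gt0 ?q_gt0 ?leq_pexp2l //.
rewrite !natrX => /le_trans; apply; rewrite exprS le_eqVlt; apply/orP; left.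
by apply/eqP; ring.
Qed.

Theorem theorem1 (F : finFieldType) (V1 V2 : finType) (n Delta1 Delta2 : nat)
    (G : bipartite_graph V1 V2 n Delta1 Delta2) (R1 R2 : rat)
    (C1 : V1 -> {vspace 'rV[F]_Delta1}) (C2 : V2 -> {vspace 'rV[F]_Delta2})
    (dimC1 : forall u : V1, (\dim (C1 u))%:R = R1 * Delta1%:R)
    (dimC2 : forall v : V2, (\dim (C2 v))%:R = R2 * Delta2%:R)
    (C_neq0 : expander_code G C1 C2 <> 0%VS) :
  let C := expander_code G C1 C2 in
  let R := code_rate C in
  exists m : rat,
    is_minimum (fun x => exists2 b' : nat, admissible #|V1| Delta1 R1 R b'
                         & x = plotkin_term #|F| n Delta1 R1 R b') m
    /\ (min_dist C)%:R <= m.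
Proof.
move=> C R; set b1 := #|V1|; pose K := \dim C.
have K_gt0 : (0 < K)%N by rewrite lt0n dimv_eq0; apply/eqP.
have n_gt0 : (0 < n)%N.
  have := dimvS (subvf C); rewrite dimvf dim_matrix mul1r.
  exact: leq_trans.
have nE : (b1 * Delta1)%N = n := card_edges _ _ _ _ _ G.
have /card_gt0P[u0 _] : (0 < b1)%N by move: n_gt0; rewrite -nE muln_gt0 => /andP[].
pose k1 := \dim (C1 u0); have k1E : k1%:R = R1 * Delta1%:R := dimC1 u0.
have dim_k1 u : \dim (C1 u) = k1.
  by apply/eqP; rewrite -(eqr_nat rat) dimC1 k1E.
(* Together with [K > 0] this forces [k1 > 0], hence [R1 != 0], so the division by [R1] in
   [admissible] is a genuine one. *)
have leK : (K <= b1 * k1)%N := dim_expander_code _ _ _ _ _ _ G C1 C2 k1 dim_k1.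
have k1_gt0 : (0 < k1)%N by have := leq_trans K_gt0 leK; rewrite muln_gt0 => /andP[].
have Delta_neq0 : Delta1%:R != 0 :> rat.
  by move: n_gt0; rewrite pnatr_eq0 -nE muln_gt0 => /andP[_]; rewrite lt0n.
have k1_neq0 : k1%:R != 0 :> rat by rewrite pnatr_eq0 -lt0n.
have R1_neq0 : R1 != 0 by apply: contraNneq k1_neq0; rewrite k1E => ->; rewrite mul0r.
have n_neq0 : n%:R != 0 :> rat by rewrite pnatr_eq0 -lt0n.
have RnE : R * n%:R = K%:R by rewrite /R /code_rate divfK.
have ktildeE b' : ktilde n Delta1 R1 R b' = b'%:R * k1%:R + K%:R - b1%:R * k1%:R.
  by rewrite /ktilde mulrBl RnE -nE natrM k1E; ring.
(* Multiplied by [k1 = R1 * Delta1], the lower bound on [b'] says that [ktilde] is at least 1. *)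
have admP b' : admissible b1 Delta1 R1 R b' <->
    (b1 * k1 < b' * k1 + K)%N /\ (b' <= b1)%N.
  rewrite /admissible -k1E.
  have -> : ((R1 - R) / R1 * b1%:R + 1 / k1%:R <= b'%:R) =
            (b1 * k1 < b' * k1 + K)%N.
    have k1_gt0R : 0 < k1%:R :> rat by rewrite ltr0n.
    have RE : R * (b1%:R * Delta1%:R) = K%:R by rewrite -natrM nE.
    rewrite -(ler_pM2r k1_gt0R) mulrDl div1r mulVf // -[in RHS](ler_nat rat).
    have -> : (R1 - R) / R1 * b1%:R * k1%:R = b1%:R * k1%:R - K%:R.
      by rewrite -RE k1E; field.
    by rewrite -addn1 !natrD !natrM; apply/idP/idP; lra.
  by [].
have bound b' : admissible b1 Delta1 R1 R b' ->
    (min_dist C)%:R <= plotkin_term #|F| n Delta1 R1 R b'.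
  move=> /admP[lt_b' le_b'].
  pose k := (b' * k1 + K - b1 * k1)%N.
  have kE : (k + b1 * k1 = b' * k1 + K)%N by rewrite /k; lia.
  have floorE : Num.floor (ktilde n Delta1 R1 R b') = k.
    rewrite ktildeE -(intrKfloor (R := rat) k) -!natrM -natrD -kE natrD addrK.
    by [].
  rewrite /plotkin_term floorE -natrM; apply: min_dist_le_ratio.
  - exact: finNzRing_gt1.
  - by rewrite /k; lia.
  - exact: min_dist_shortened dim_k1 le_b' kE.
pose P (i : 'I_b1.+1) := (b1 * k1 < i * k1 + K)%N.
(* The choice [b' = b1] gives [ktilde = K > 0], so the finite set of admissible values is nonempty
   and the minimum is attained. *)
have P_max : P ord_max by rewrite /P /=; lia.
pose m (i : 'I_b1.+1) := plotkin_term #|F| n Delta1 R1 R i.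
case: (arg_minP m P_max) => i Pi min_i.
have adm_i : admissible b1 Delta1 R1 R i by apply/admP; split; last by rewrite -ltnS ltn_ord.
exists (m i); split; last exact: bound.
split=> [|_ [b' /admP[lt_b' le_b'] ->]]; first by exists (i : nat).
have lt_b1 : (b' < b1.+1)%N by rewrite ltnS.
exact: (min_i (Ordinal lt_b1)).
Qed.
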